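(* Let $d\ge1$ and let $\Psi_{-1},\Psi_0,\Psi_1\in M_d(\mathbb{C})$ be such that $\Psi(e^{\mathrm{i}\theta})=\Psi_0+\Psi_1e^{\mathrm{i}\theta}+\Psi_{-1}e^{-\mathrm{i}\theta}$ is Hermitian positive definite for all $\theta\in[0,2\pi]$, and such that $\Psi_1$ is invertible. Suppose that $\Psi$ satisfies Assumption II. Let $G_L=\Psi_{-1}(W_{>1}(\Psi))^{-1}$ and $G_R=\Psi_1W_{<1}(\Psi)$. Then for all integers $P\ge1$, $$\det T_P^{G_L,G_R}(\Psi)=\exp\left(\frac1{2\pi}\int_0^{2\pi}\log\det\Psi(e^{\mathrm{i}\theta})\,d\theta\right)^P\kappa(G_L,G_R),\qquad \kappa(G_L,G_R)=\det(G_L+G_R+\Psi_0).$$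
   Context: Extend $\Psi$ to $z\in\mathbb{C}^*$ by $\Psi(z)=\Psi_0+\Psi_1z+\Psi_{-1}z^{-1}$. Let $\mathcal{S}=\{z\in\mathbb{C}^*:\det\Psi(z)=0\}$, $\mathcal{S}_{<1}=\{w\in\mathcal{S}:|w|<1\}$, $\mathcal{S}_{>1}=\{w\in\mathcal{S}:|w|>1\}$. Assumption II: every $w\in\mathcal{S}$ is a simple root of the polynomial $z^d\det\Psi(z)$ and $\dim\ker\Psi(w)=1$. For each $w\in\mathcal{S}$ fix $u_w\ne0$ spanning $\ker\Psi(w)$. Under the hypotheses of the claim, $(u_w)_{w\in\mathcal{S}_{<1}}$ and $(u_w)_{w\in\mathcal{S}_{>1}}$ are bases of $\mathbb{C}^d$; $W_{<1}(\Psi)$ and $W_{>1}(\Psi)$ are the $d\times d$ matrices with $W_{<1}(\Psi)u_w=wu_w$ for $w\in\mathcal{S}_{<1}$ and $W_{>1}(\Psi)u_w=wu_w$ for $w\in\mathcal{S}_{>1}$. Toeplitz matrix with boundary conditions: for $G_L,G_R\in M_d(\mathbb{C})$, $T_P^{G_L,G_R}(\Psi)$ is the $(P+1)\times(P+1)$ block matrix with $d\times d$ blocks which is block tridiagonal with all diagonal blocks equal to $\Psi_0$ except that the $(1,1)$ block is $G_L+\Psi_0$ and the $(P+1,P+1)$ block is $G_R+\Psi_0$, with $(k,k+1)$ blocks equal to $\Psi_1$ and $(k+1,k)$ blocks equal to $\Psi_{-1}$ for $1\le k\le P$, and all other blocks zero. *)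

(* Defs.v *)
From HB Require Import structures.
From mathcomp Require Import all_boot all_order all_algebra.
From mathcomp Require Import all_classical all_reals all_analysis.
From mathcomp Require Import complex.

Set Implicit Arguments.
Unset Strict Implicit.
Unset Printing Implicit Defensive.

Import Order.TTheory GRing.Theory Num.Theory.

Local Open Scope classical_set_scope.
Local Open Scope ring_scope.
Local Open Scope complex_scope.
Local Open Scope sesquilinear_scope.

Definition expi (R : realType) (t : R) : R[i] := cos t +i* sin t.

Lemma expiN (R : realType) (t : R) : expi (- t) = (expi t)^-1.
Proof.
have ex1 : expi t * expi (- t) = 1.
  apply/eqP; rewrite eq_complex /= cosN sinN mulrN opprK -!expr2 cos2Dsin2.
  by rewrite eqxx /= mulrN mulrC addNr.
have ex0 : expi t != 0.
  by apply: contra_eq_neq ex1 => ->; rewrite mul0r eq_sym oner_neq0.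
by apply: (mulfI ex0); rewrite ex1 mulfV.
Qed.

Definition herm_posdef (C : numClosedFieldType) (d : nat) (A : 'M[C]_d) :=
  A \is hermsymmx /\
  forall v : 'cV[C]_d, v != 0 -> 0 < (v ^t* *m A *m v) 0 0.

(* [rker A] spans, as rows, the kernel {v | A v = 0} acting on columns
   ([kermx] is the kernel acting on rows). *)
Definition rker (F : fieldType) (d : nat) (A : 'M[F]_d) : 'M[F]_d := kermx A^T.

Section Symbol.
Context {C : fieldType} {d : nat} (Psim1 Psi0 Psi1 : 'M[C]_d).

Definition Psi (z : C) : 'M[C]_d := Psi0 + z *: Psi1 + z^-1 *: Psim1.

Definition zeros : set C := [set z | z != 0 /\ \det (Psi z) = 0].

(* z ^ d * det (Psi z) = det (z * Psi z) as a polynomial in z; see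
   [detPsi_polyE]. *)
Definition detPsi_poly : {poly C} :=
  \det (map_mx polyC Psim1 + 'X *: map_mx polyC Psi0
        + 'X^2 *: map_mx polyC Psi1).

Lemma detPsi_polyE z : z != 0 -> detPsi_poly.[z] = z ^+ d * \det (Psi z).
Proof.
move=> z0; rewrite -detZ -horner_evalE -det_map_mx; congr (\det _).
apply/matrixP => i j; rewrite !mxE /= /horner_eval !hornerE.
by rewrite !mulrDr !(mulrA z) mulfV // mul1r -expr2 [RHS]addrC addrA.
Qed.

Definition assumptionII :=
  forall w, zeros w -> mup w detPsi_poly = 1%N /\ \rank (rker (Psi w)) = 1%N.

Definition kernel_vectors (u : C -> 'cV[C]_d) :=
  forall w, zeros w -> u w != 0 /\ ((u w)^T == rker (Psi w))%MS.

(* The matrix W with W u_w = w u_w for all w in A; it is unique when the u_w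
   span the whole space, and exists when they are linearly independent. *)
Definition eigmx (A : set C) (u : C -> 'cV[C]_d) : 'M[C]_d :=
  xget 0 [set W | forall w, A w -> W *m u w = w *: u w].

Definition toeplitz_block (GL GR : 'M[C]_d) (P : nat) (i j : 'I_P.+1) :
    'M[C]_d :=
  if i == j then
    (if i == ord0 then GL else 0) + (if i == ord_max then GR else 0) + Psi0
  else if j == i.+1 :> nat then Psi1
  else if i == j.+1 :> nat then Psim1
  else 0.

Definition toeplitz (GL GR : 'M[C]_d) (P : nat) :=
  \mxblock_(i < P.+1, j < P.+1) toeplitz_block GL GR i j.

End Symbol.

Section Zeros.
Context {R : realType} {d : nat} (Psim1 Psi0 Psi1 : 'M[R[i]]_d).
Local Notation S := (zeros Psim1 Psi0 Psi1).

Definition zeros_lt1 : set R[i] := [set w | S w /\ `|w| < 1].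
Definition zeros_gt1 : set R[i] := [set w | S w /\ 1 < `|w|].

Definition W_lt1 (u : R[i] -> 'cV[R[i]]_d) : 'M[R[i]]_d := eigmx zeros_lt1 u.
Definition W_gt1 (u : R[i] -> 'cV[R[i]]_d) : 'M[R[i]]_d := eigmx zeros_gt1 u.

(* On the unit circle det Psi is real, so its real part is the determinant
   itself. *)
Definition mean_log_det : R :=
  (2 * pi)^-1 * \int[lebesgue_measure]_(t in `[0, 2 * pi])
    ln (complex.Re (\det (Psi Psim1 Psi0 Psi1 (expi t)))).

End Zeros.

(* Main.v *)
(** Write [A, B, M] for [Psi1, Psi0, Psim1] and [V, W] for [W_gt1, W_lt1].
    Since [A V^2 + B V + M = 0], the symbol factors as
    [Psi(z) = (A - GL / z) (z - V)] with [GL = M V^-1], and the boundary blocks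
    are exactly those for which the Toeplitz matrix is the product of two block
    bidiagonal matrices; hence its determinant is
    [(det A det (- V))^P det (A (W - V))], and [A (W - V) = GL + GR + Psi0].

    The zeros are symmetric under [w -> 1 / conj w], so on the unit circle
    [det Psi(z) = det A det (- V) \prod_v |1 - z / v|^2] over the zeros [v]
    outside the disc. The integral [I(a)] of [ln |1 - a e^(it)|^2] vanishes for
    [|a| < 1], because [I(a^2) = 2 I(a)] and [I] is bounded on [|a| <= r < 1].

    That there are [d] zeros on each side follows from the independence of the
    kernel vectors inside the disc: if [\sum_w c_w u_w = 0], then
    [f(z) = \sum_w c_w w / (z - w) u_w] satisfies [Psi(z) f(z) = b] with [b]
    constant; positivity makes [b^* f] real on the circle, where its conjugate
    only has poles outside the disc, so comparing partial fractions gives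
    [b^* f = 0], then [f^* Psi f = 0], and finally [f = 0]. *)

Require Import Defs.
From HB Require Import structures.
From mathcomp Require Import all_boot all_order all_algebra.
From mathcomp Require Import all_classical all_reals all_analysis.
From mathcomp Require Import complex ring lra.

Import Order.TTheory GRing.Theory Num.Theory.
Import numFieldNormedType.Exports.

Local Open Scope classical_set_scope.
Local Open Scope ring_scope.
Local Open Scope complex_scope.
Local Open Scope sesquilinear_scope.

Set Implicit Arguments.
Unset Strict Implicit.
Unset Printing Implicit Defensive.

(** * Block triangular determinants and the factored Toeplitz matrix *)

Lemma det_castmx (K : comPzRingType) (m n : nat) (e e' : m = n)
    (A : 'M[K]_m) :
  \det (castmx (e, e') A) = \det A.
Proof. by case: n / e e' => e'; rewrite castmx_id. Qed.

Lemma det_mxblock_lower (K : comPzRingType) (n : nat) (p_ : 'I_n -> nat)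
    (B_ : forall i j, 'M[K]_(p_ i, p_ j)) :
    (forall i j : 'I_n, (i < j)%N -> B_ i j = 0) ->
  \det (\mxblock_(i, j) B_ i j) = \prod_i \det (B_ i i).
Proof.
elim: n => [|n IHn] in p_ B_ * => B0.
  rewrite [RHS]big_ord0.
  (* The size is an empty sum, equal to 0 only by rewriting; it is generalized so that the matrix
     can be retyped. *)
  move: (\mxblock_(_, _) _) (@big_ord0 nat 0%N addn xpredT p_).
  by move: (\sum_i _)%N => m M m0; rewrite m0 in M *; rewrite det_mx00.
rewrite mxblock_recul det_castmx big_ord_recl.
under eq_mxrow do rewrite B0 //.
rewrite mxrow0.
by rewrite det_lblock IHn // => i j ij; rewrite B0.
Qed.

Lemma det_mxblock_upper (K : comPzRingType) (n : nat) (p_ : 'I_n -> nat)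
    (B_ : forall i j, 'M[K]_(p_ i, p_ j)) :
    (forall i j : 'I_n, (j < i)%N -> B_ i j = 0) ->
  \det (\mxblock_(i, j) B_ i j) = \prod_i \det (B_ i i).
Proof.
move=> B0; rewrite -det_tr tr_mxblock det_mxblock_lower => [|i j /B0 ->].
  by apply: eq_bigr => i _; rewrite det_tr.
exact: trmx0.
Qed.

(* [D = M V^-1] and [- D - A V = B] for a solution [V] of [A V^2 + B V + M = 0],
   as [z^2 A + z B + M = (z A - D) (z - V)]; the two factors here are the
   Toeplitz matrices of [A - D / z] and [z - V], up to the last corner. *)
Lemma toeplitz_factorization (K : fieldType) (d P : nat)
    (A V W D : 'M[K]_d) :
  toeplitz (D *m V) (- D - A *m V) A D (A *m W) P =
  (\mxblock_(i < P.+1, j < P.+1)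
     (if i == j then A else if i == j.+1 :> nat then - D else 0)) *m
  (\mxblock_(i < P.+1, j < P.+1)
     (if i == j then (if i == ord_max then W else 0) - V
      else if j == i.+1 :> nat then 1%:M else 0)).
Proof.
rewrite mul_mxblock; apply: eq_mxblock => i k.
rewrite (bigD1 i) //= eqxx /toeplitz_block.
(* Row [i] of the left factor is nonzero only in columns [i] and [i - 1]. Row 0 lacks the second
   block, whose contribution [- D] is what the boundary block [D] cancels. *)
case: (unliftP ord0 i) => [i' ->|->]; last first.
  rewrite big1 => [|j /negPf ji]; last first.
    by rewrite eq_sym ji mul0mx.
  rewrite addr0 /=; case: (eqVneq ord0 k) => _.
    by rewrite addrACA subrr add0r mulmxBr; case: ifP; rewrite ?mulmx0.
  by case: ifP => _; rewrite ?mulmx1 ?mulmx0.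
rewrite (bigD1 (widen_ord (leqnSn P) i')) /=; last first.
  by rewrite -val_eqE /= neq_ltn ltnSn.
rewrite big1 => [|j]; last first.
  rewrite -!val_eqE /= /bump /= add1n eqSS => /andP[/negPf ji /negPf ji'].
  by rewrite eq_sym ji eq_sym ji' mul0mx.
rewrite addr0 eqSS -!val_eqE /= /bump /= add1n eqxx.
rewrite (gtn_eqF (ltnSn i')) ?(ltn_eqF (ltn_ord i')).
case: (eqVneq i'.+1 (k : nat)) => [<-|ik].
  rewrite (ltn_eqF (ltnSn i')) mulmx1 add0r mulmxBr addrA addrAC.
  by case: ifP; rewrite ?mulmx0.
case: (eqVneq (i' : nat) k) => [<-|_]; last first.
  by rewrite mulmx0 addr0; case: ifP; rewrite ?mulmx0 ?mulmx1.
by rewrite (ltn_eqF (leqnSn i'.+1)) mulmx0 !add0r mulmxN mulNmx opprK.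
Qed.

(** The diagonal blocks are [A] in all [P + 1] rows of one factor, and [- V] with a last [W - V] in
    the other; the surplus [\det A] joins the last block. *)
Lemma det_toeplitz_factored (K : fieldType) (d P : nat) (A V W D : 'M[K]_d) :
  \det (toeplitz (D *m V) (- D - A *m V) A D (A *m W) P) =
  (\det A * \det (- V)) ^+ P * \det (A *m (W - V)).
Proof.
rewrite toeplitz_factorization det_mulmx.
rewrite det_mxblock_lower => [|i j ij]; last first.
  by rewrite -val_eqE /= (ltn_eqF ij) (ltn_eqF (leqW ij)).
rewrite det_mxblock_upper => [|i j ij]; last first.
  by rewrite -val_eqE /= (gtn_eqF ij) (ltn_eqF (leqW ij)).
under eq_bigr do rewrite eqxx.
rewrite prodr_const card_ord.
under eq_bigr do rewrite eqxx.
rewrite big_ord_recr /= eqxx.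
under eq_bigr => i _ do rewrite -val_eqE /= (ltn_eqF (ltn_ord i)) sub0r.
rewrite prodr_const card_ord exprSr det_mulmx exprMn; ring.
Qed.

(** * Degree and extreme coefficients of [z ^ d * det Psi(z)] *)

Section MatrixPolynomial.

(** The product [U *m L *m U] is a signed swap of the two block columns, of determinant 1; it makes
    the matrix block lower triangular. *)
Lemma det_block_0N1 (K : comNzRingType) (d : nat) (Q Y : 'M[K]_d) :
  \det (block_mx 0 (- 1%:M) Q Y) = \det Q.
Proof.
pose U : 'M[K]_(d + d) := block_mx 1%:M 1%:M 0 1%:M.
pose L : 'M[K]_(d + d) := block_mx 1%:M 0 (- 1%:M) 1%:M.
have detJ : \det (U *m L *m U) = 1.
  by rewrite !det_mulmx det_ublock det_lblock !det1 !mulr1.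
rewrite -[LHS]mulr1 -[X in _ * X = _]detJ -det_mulmx /U /L !mulmx_block.
rewrite !(mul0mx, mulmx0, mul1mx, mulmx1, mulmxN, mulNmx,
  add0r, addr0, subrr, addNr, opprK, oppr0).
by rewrite det_lblock det1 mul1r.
Qed.

Context {K : fieldType} {d : nat} (M B A : 'M[K]_d).

(* The block matrix is the companion matrix of [A^-1 (M + z B + z^2 A)]. *)
Lemma detPsi_poly_char_poly : A \in unitmx ->
  detPsi_poly M B A =
  \det A *: char_poly (block_mx 0 1%:M (- (invmx A *m M)) (- (invmx A *m B))).
Proof.
move=> uA; rewrite /detPsi_poly /char_poly /char_poly_mx.
rewrite map_block_mx !map_mxN map_mx0 map_mx1.
rewrite scalar_mx_block opp_block_mx add_block_mx.
rewrite !(opprK, oppr0, add0r, addr0).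
(* Adding ['X] times the second block column to the first clears the upper left block. *)
pose L : 'M[{poly K}]_(d + d) := block_mx 1%:M 0 'X%:M 1%:M.
have detL : \det L = 1 by rewrite det_lblock !det1 mulr1.
rewrite -[\det (block_mx _ _ _ _)]mulr1 -[X in _ *: (_ * X)]detL.
rewrite -det_mulmx mulmx_block.
rewrite !(mulmx1, mulmx0, add0r, addr0) mulNmx mul1mx subrr det_block_0N1.
rewrite -mul_polyC -det_map_mx -det_mulmx; congr (\det _).
rewrite mulmxDr -map_mxM mulKVmx // scalar_mxC.
rewrite mul_scalar_mx -scalemxAr mulmxDr -map_mxM mulKVmx //.
rewrite scalerDr mul_mx_scalar.
by rewrite scalerA -expr2 -addrA (addrC ('X *: _)).
Qed.

Lemma lead_coef_detPsi_poly : A \in unitmx ->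
  lead_coef (detPsi_poly M B A) = \det A.
Proof.
move=> uA; rewrite detPsi_poly_char_poly // lead_coefZ.
by rewrite (monicP (char_poly_monic _)) mulr1.
Qed.

Lemma size_detPsi_poly : A \in unitmx -> size (detPsi_poly M B A) = (d + d).+1.
Proof.
move=> uA; rewrite detPsi_poly_char_poly // size_scale ?size_char_poly //.
by rewrite -unitfE -unitmxE.
Qed.

Lemma detPsi_poly0 : (detPsi_poly M B A).[0] = \det M.
Proof.
rewrite /detPsi_poly -horner_evalE -det_map_mx; congr (\det _).
apply/matrixP => i j.
by rewrite !mxE /= /horner_eval !hornerE expr0n mul0r !addr0.
Qed.

End MatrixPolynomial.

(** * Matrices determined by their eigenvectors *)

Section Eigenvectors.
Context {F : fieldType} {d n : nat} (u : F -> 'cV[F]_d) (s : n.-tuple F).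

Definition vecs_mx : 'M[F]_(n, d) := \matrix_(j < n) (u (tnth s j))^T.

Lemma row_free_vecs_mx : uniq s ->
    (forall c : F -> F, \sum_(w <- s) c w *: u w = 0 ->
       forall w, w \in s -> c w = 0) ->
  row_free vecs_mx.
Proof.
move=> us indep; apply: inj_row_free => v v0.
pose c w := \sum_(j < n | tnth s j == w) v 0 j.
have cE j : c (tnth s j) = v 0 j.
  by rewrite /c (big_pred1 j) // => k /=; rewrite (inj_eq (tuple_uniqP _ us)).
have c0 : \sum_(w <- s) c w *: u w = 0.
  apply: trmx_inj; rewrite trmx0 -v0 mulmx_sum_row big_tuple raddf_sum /=.
  by apply: eq_bigr => j _; rewrite cE rowK linearZ.
by apply/rowP => j; rewrite mxE -cE (indep c c0) // mem_tnth.
Qed.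

End Eigenvectors.

Section Eigmx.
Context {F : fieldType} {d : nat} (u : F -> 'cV[F]_d) (s : d.-tuple F).
Hypothesis us : row_free (vecs_mx u s).

Let U := (vecs_mx u s)^T.

Let unitU : U \in unitmx.
Proof. by rewrite unitmx_tr -row_free_unit. Qed.

Let colU j : col j U = u (tnth s j).
Proof. by apply/colP => i; rewrite !mxE. Qed.

Let mulU (X : 'M[F]_d) j : X *m u (tnth s j) = col j (X *m U).
Proof. by rewrite -colU !colE mulmxA. Qed.

Lemma eigmxP (S : set F) : (forall w, S w <-> w \in s) ->
  forall w, w \in s -> eigmx S u *m u w = w *: u w.
Proof.
move=> Ss w ws; have : exists W : 'M[F]_d, forall w, S w -> W *m u w = w *: u w.
  (* A witness is needed for [xget] to return a solution and not its default 0. *)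
  exists (U *m diag_mx (\row_j tnth s j) *m invmx U) => _ /Ss /tnthP [j ->].
  rewrite mulU mulmxKV // -colU; apply/colP => i.
  by rewrite mul_mx_diag !mxE mulrC.
by move/(xgetPex (0 : 'M[F]_d)); apply; apply/Ss.
Qed.

Lemma det_eigvecs (W : 'M[F]_d) : (forall w, w \in s -> W *m u w = w *: u w) ->
  \det W = \prod_(w <- s) w.
Proof.
move=> Wu; have : W *m U = U *m diag_mx (\row_j tnth s j).
  apply/matrixP => i j; have := Wu (tnth s j) (mem_tnth j s).
  rewrite mulU -?colU => /colP /(_ i); rewrite mul_mx_diag !mxE => ->.
  by rewrite mulrC.
move=> /(congr1 determinant); rewrite !det_mulmx det_diag mulrC.
have U0 : \det U != 0 by rewrite -unitfE -unitmxE.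
move=> /(mulfI U0) ->; rewrite big_tuple.
by apply: eq_bigr => j _; rewrite mxE.
Qed.

Lemma mx_eq0_vecs (X : 'M[F]_d) : (forall w, w \in s -> X *m u w = 0) -> X = 0.
Proof.
move=> Xu; have XU : X *m U = 0.
  apply/matrixP => i j; have := Xu (tnth s j) (mem_tnth j s).
  by rewrite mulU -?colU => /colP /(_ i); rewrite !mxE.
by rewrite -(mulmxK unitU X) XU mul0mx.
Qed.

End Eigmx.

(** * Changes of variable in integrals over a segment *)

Section Substitution.
Context {R : realType}.
Notation mu := (@lebesgue_measure R).

Lemma continuous_itv_integrable (f : R -> R) (a b : R) : continuous f ->
  mu.-integrable `[a, b] (EFin \o f).
Proof.
move=> cf; apply: continuous_compact_integrable; first exact: segment_compact.
exact: continuous_subspaceT.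
Qed.

Lemma Rintegral_affine (G : R -> R) (k c a b : R) : 0 < k -> a <= b ->
    continuous G ->
  \int[mu]_(x in `[k * a + c, k * b + c]) G x =
  k * \int[mu]_(x in `[a, b]) G (k * x + c).
Proof.
move=> k0 ab cG.
have dF (x : R) : is_derive x 1 (fun x : R => k * x + c) k.
  by apply: is_derive_eq; rewrite addr0 /GRing.scale /= mulr1.
have F'E : derive1 (fun x : R => k * x + c) = cst k.
  by apply/funext => x; rewrite derive1E derive_val.
have cF : continuous (fun x : R => k * x + c).
  move=> x; apply: differentiable_continuous.
  by apply/derivable1_diffP; have [] := dF x.
rewrite /Rintegral.
rewrite (@integration_by_substitution_increasing R (fun x => k * x + c)) //.
- rewrite F'E.
  rewrite -[in RHS]RintegralZl //; last first.
    apply: continuous_itv_integrable => x.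
    by apply: continuous_comp; [exact: cF|exact: cG].
  rewrite /Rintegral; congr fine; apply: eq_integral => x _.
  by rewrite /= mulrC.
- by move=> x y _ _ xy; rewrite ltrD2r ltr_pM2l.
- by rewrite F'E => x _; exact: cvg_cst.
- by rewrite F'E; exact: is_cvg_cst.
- by rewrite F'E; exact: is_cvg_cst.
- split => [x _| |]; first by have [] := dF x.
  + by apply: cvg_at_right_filter; exact: cF.
  + by apply: cvg_at_left_filter; exact: cF.
- exact: continuous_subspaceT.
Qed.

(* Substitute [s = 2 t], then split the interval at [pi] and shift by [pi]. *)
Lemma Rintegral_double (g h : R -> R) : continuous g -> continuous h ->
    (forall t, h (2 * t) = g t + g (t + pi)) ->
  \int[mu]_(x in `[0, 2 * pi]) h x = 2 * \int[mu]_(x in `[0, 2 * pi]) g x.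
Proof.
move=> cg ch hg.
have pi0 : 0 <= pi :> R by rewrite pi_ge0.
have cgpi : continuous (fun t => g (t + pi)).
  move=> x; apply: (@continuous_comp _ _ _ (fun t => t + pi) g); last exact: cg.
  by apply: cvgD; [exact: cvg_id|exact: cvg_cst].
have e0 : (2 : R) * 0 + 0 = 0 by rewrite mulr0 addr0.
have := @Rintegral_affine h 2 0 0 pi (ltr0Sn R 1) pi0 ch.
rewrite e0 addr0 => ->; congr (_ * _).
under eq_Rintegral do rewrite addr0 hg.
rewrite RintegralD //; [|exact: continuous_itv_integrable..].
have := @Rintegral_affine g 1 pi 0 pi ltr01 pi0 cg.
have -> : (1 : R) * 0 + pi = pi by rewrite mulr0 add0r.
have -> : (1 : R) * pi + pi = 2 * pi by rewrite mul1r mulr_natl mulr2n.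
rewrite mul1r.
under [in X in _ = X -> _]eq_Rintegral do rewrite mul1r.
move=> <-.
have ig := continuous_itv_integrable _ _ cg.
rewrite -(Rintegral_itv_obnd_cbnd (r := pi)); last first.
  apply: integrableS (ig pi (2 * pi)) => //.
  by apply: subset_itvr; rewrite bnd_simp.
rewrite -(Rintegral_itvB (ig 0 (2 * pi))) ?bnd_simp //.
  by rewrite addrC subrK.
by rewrite ler_peMl // ler1n.
Qed.

End Substitution.

(** * Jensen's formula for a linear factor with no zero in the closed disc *)

Section Jensen.
Context {R : realType}.
Notation mu := (@lebesgue_measure R).

(** The squared modulus as a real number: [ln] takes reals, while the norm of [R[i]] has values in
    [R[i]]. *)
Definition nsq (z : R[i]) : R := complex.Re z ^+ 2 + complex.Im z ^+ 2.

Lemma nsqC z : (nsq z)%:C = z * z^*%C.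
Proof. by rewrite add_Re2_Im2 sqr_normc. Qed.

Lemma nsq_gt0 z : (0 < nsq z) = (z != 0).
Proof.
case: (eqVneq z 0) => [->|z0]; first by rewrite /nsq /= expr0n addr0 ltxx.
by rewrite -ltcR nsqC -sqr_normc exprn_gt0 ?normr_gt0.
Qed.

Lemma nsqM z w : nsq (z * w) = nsq z * nsq w.
Proof. by case: z w => [a b] [c d]; rewrite /nsq /=; ring. Qed.

Lemma expiD (s t : R) : expi (s + t) = expi s * expi t.
Proof. by rewrite /expi cosD sinD; simpc; rewrite (addrC (_ * sin t)). Qed.

Lemma expi_pi : expi (pi : R) = -1.
Proof. by rewrite /expi cospi sinpi; simpc. Qed.

Lemma norm_expi (t : R) : `|expi t| = 1.
Proof. by rewrite normc_def /= cos2Dsin2 sqrtr1. Qed.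

Lemma nsq_1B (a : R[i]) t : nsq (1 - a * expi t) =
  1 - 2 * (complex.Re a * cos t - complex.Im a * sin t) + nsq a.
Proof.
have c2 : cos t ^+ 2 = 1 - sin t ^+ 2 by rewrite -(cos2Dsin2 t) addrK.
by case: a => a b; rewrite /nsq /=; ring: c2.
Qed.

Lemma one_sub_expi_neq0 (a : R[i]) t : `|a| < 1 -> 1 - a * expi t != 0.
Proof.
apply: contraTneq => /eqP; rewrite subr_eq0 => /eqP /(congr1 Num.norm).
by rewrite normrM norm_expi mulr1 normr1 => <-; rewrite ltxx.
Qed.

Lemma continuous_ln_nsq (a : R[i]) : `|a| < 1 ->
  continuous (fun t : R => ln (nsq (1 - a * expi t))).
Proof.
move=> a1 t; apply: (@continuous_comp _ _ _ (fun t => nsq (1 - a * expi t))).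
  have -> : (fun t => nsq (1 - a * expi t)) = (fun t =>
      1 - 2 * (complex.Re a * cos t - complex.Im a * sin t) + nsq a).
    by apply/funext => s; rewrite nsq_1B.
  apply: cvgD; last exact: cvg_cst.
  apply: cvgB; first exact: cvg_cst.
  apply: cvgM; first exact: cvg_cst.
  by apply: cvgB; apply: cvgM; (try exact: cvg_cst);
    [exact: continuous_cos|exact: continuous_sin].
by apply: continuous_ln; rewrite nsq_gt0 one_sub_expi_neq0.
Qed.

(** By the triangle inequality the argument of [ln] lies between [(1 - r) ^+ 2] and 4, uniformly in
    [t] and in [a] within the disc of radius [r]. *)
Lemma ln_nsq_bound (a : R[i]) (r t : R) : `|a| <= r%:C -> r < 1 ->
  `|ln (nsq (1 - a * expi t))| <= `|ln ((1 - r) ^+ 2)| + ln 4.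
Proof.
move=> ar r1.
have a1 : `|a| < 1 by rewrite (le_lt_trans ar) // ltcR.
have nE : `|a * expi t| = `|a| by rewrite normrM norm_expi mulr1.
have lo : (1 - r) ^+ 2 <= nsq (1 - a * expi t).
  rewrite -lecR nsqC -sqr_normc rmorphXn /= lerXn2r ?nnegrE //.
    by rewrite -[0]/(0%:C) lecR subr_ge0 ltW.
  rewrite rmorphB /= (le_trans (lerB (lexx _) ar)) //.
  by rewrite rmorph1 -nE -[1 in X in X <= _]normr1 lerB_dist.
have hi : nsq (1 - a * expi t) <= 4.
  rewrite -lecR nsqC -sqr_normc (_ : 4%:C = 2 ^+ 2); last first.
    by rewrite -natrX -(rmorph_nat (real_complex R)).
  rewrite lerXn2r ?nnegrE //.
  rewrite (le_trans (ler_normB _ _)) // nE normr1.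
  by rewrite -[2](@natrD _ 1 1) lerD2l ltW.
have r0 : 0 < (1 - r) ^+ 2 by rewrite exprn_gt0 // subr_gt0.
have n0 := lt_le_trans r0 lo.
have l1 : ln ((1 - r) ^+ 2) <= ln (nsq (1 - a * expi t)) by rewrite ler_ln.
have l2 : ln (nsq (1 - a * expi t)) <= ln 4 by rewrite ler_ln // posrE.
have l4 : 0 <= ln (4 : R) by rewrite ln_ge0 // ler1n.
have := ler_norm (- ln ((1 - r) ^+ 2)); rewrite normrN => l5.
have l6 := normr_ge0 (ln ((1 - r) ^+ 2)).
rewrite ler_norml; apply/andP; split; first by lra.
by rewrite (le_trans l2) // lerDr.
Qed.

Lemma Rintegral_ln_nsq (a : R[i]) : `|a| < 1 ->
  \int[mu]_(t in `[0, 2 * pi]) ln (nsq (1 - a * expi t)) = 0.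
Proof.
pose I a := \int[mu]_(t in `[0, 2 * pi]) ln (nsq (1 - a * expi t)).
(* As [expi (t + pi) = - expi t], the factors at [t] and [t + pi] multiply to
   [1 - b ^+ 2 * expi (2 * t)]. *)
have dbl (b : R[i]) : `|b| < 1 -> I (b ^+ 2) = 2 * I b.
  move=> b1; apply: Rintegral_double.
  - exact: continuous_ln_nsq.
  - by apply: continuous_ln_nsq; rewrite normrX expr_lt1.
  - move=> t; rewrite expiD expi_pi -lnM ?posrE ?nsq_gt0 ?one_sub_expi_neq0 //.
      rewrite -nsqM mulr_natl mulr2n expiD; congr (ln (nsq _)); ring.
    by rewrite mulrN1 mulrN -mulNr one_sub_expi_neq0 ?normrN.
move=> a1.
have [r ra] : exists r, r%:C = `|a| by rewrite normc_def; eexists.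
have r1 : r < 1 by rewrite -ltcR ra.
have r0 : 0 <= r by rewrite -ler0c ra.
pose K := `|ln ((1 - r) ^+ 2)| + ln 4.
pose M := \int[mu]_(t in `[0, 2 * pi]) (cst K) t.
(* The disc of radius [r] is stable under squaring, so the same [M] serves for every number of
   halvings. *)
have bnd n (b : R[i]) : `|b| <= r%:C -> `|I b| <= M / 2 ^+ n.
  elim: n b => [|n IHn] b br.
    have b1 : `|b| < 1 by rewrite (le_lt_trans br) // ltcR.
    have cb := continuous_ln_nsq b1.
    rewrite expr0 divr1; apply: (le_trans (le_normr_Rintegral _ _)) => //.
      exact: continuous_itv_integrable.
    apply: le_Rintegral => //.
    - pose q t : R := ln (nsq (1 - b * expi t)).
      apply: (@continuous_itv_integrable _ (fun t => `|q t|)) => t.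
      apply: (@continuous_comp _ _ _ q Num.norm); first exact: cb.
      exact: (@norm_continuous _ R).
    - by apply: (@continuous_itv_integrable _ (cst K)) => t; exact: cvg_cst.
    - by move=> t _; exact: ln_nsq_bound.
  have b1 : `|b| < 1 by rewrite (le_lt_trans br) // ltcR.
  have /IHn : `|b ^+ 2| <= r%:C.
    by rewrite normrX (le_trans _ br) // expr2 ler_piMl // ltW.
  rewrite dbl // normrM ger0_norm ?ler0n // exprS invfM.
  by rewrite mulrCA ler_pdivlMl.
have := bnd _ a; rewrite -ra lexx => {}bnd.
apply/eqP; rewrite -normr_le0 leNgt; apply/negP => I0.
have [n] : exists n, M / `|I a| < 2 ^+ n.
  exists (Num.bound (M / `|I a|)); apply: upper_nthrootP; exact: leqnn.
rewrite ltr_pdivrMr // => /lt_le_trans /(_ _) lt.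
by have := bnd n isT; rewrite ler_pdivlMr ?exprn_gt0 // leNgt mulrC lt.
Qed.
End Jensen.

(** * Uniqueness of partial fractions on the unit circle *)

Section PartialFractions.
Context {R : realType}.
Notation C := R[i].

Lemma poly_circle_eq0 (p : {poly C}) :
  (forall t : R, 0 <= t <= 2 * pi -> p.[expi t] = 0) -> p = 0.
Proof.
(* The angles [1 / (k + 1)] lie in [[0, pi]], where [cos] is injective; they supply [size p]
   distinct roots. *)
move=> p0; pose x (k : nat) : R := k.+1%:R^-1.
have x0 k : 0 <= x k by rewrite invr_ge0 ler0n.
have x1 k : x k <= 1 by rewrite invf_le1 ?ltr0n ?ler1n.
have xpi k : x k <= pi.
  by rewrite (le_trans (x1 k)) // (le_trans _ (pi_ge2 R)) // ler1n.
apply: (@roots_geq_poly_eq0 _ _ [seq expi (x k) | k <- iota 0 (size p)]).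
- apply/allP => _ /mapP [k _ ->]; apply/rootP/p0.
  rewrite x0 (le_trans (xpi k)) //.
  by rewrite ler_peMl ?pi_ge0 // ler1n.
- rewrite map_inj_uniq ?iota_uniq // => j k [/cos_inj].
  rewrite !in_itv /= !x0 !xpi => /(_ isT isT) /invr_inj /eqP.
  by rewrite eqr_nat => /eqP [].
- by rewrite size_map size_iota.
Qed.

(** Clearing denominators gives a polynomial that vanishes on the circle, hence is 0; its value at
    [p] is [g p] times nonzero differences. *)
Lemma partial_fractions_eq0 (s : seq C) (g : C -> C) : uniq s ->
    (forall p, p \in s -> `|p| != 1) ->
    (forall t : R, 0 <= t <= 2 * pi -> \sum_(p <- s) g p / (expi t - p) = 0) ->
  forall p, p \in s -> g p = 0.
Proof.
move=> us s1 sum0 p ps.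
pose Q : {poly C} := \sum_(p <- s) g p *: \prod_(q <- s | q != p) ('X - q%:P).
have Q0 : Q = 0.
  apply: poly_circle_eq0 => t t02.
  have tN q : q \in s -> expi t - q != 0.
    move=> /s1; rewrite subr_eq0; apply: contraNneq => <-.
    by rewrite norm_expi.
  transitivity ((\prod_(q <- s) (expi t - q)) *
      \sum_(p <- s) g p / (expi t - p)); last by rewrite sum0 ?mulr0.
  rewrite horner_sum mulr_sumr; apply: eq_big_seq => q qs.
  rewrite (bigD1_seq q) //= hornerZ horner_prod.
  under eq_bigr do rewrite hornerXsubC.
  by field; exact: tN.
have := congr1 (horner^~ p) Q0; rewrite horner0 horner_sum (bigD1_seq p) //=.
rewrite [X in _ + X]big1 ?addr0.
  rewrite hornerZ horner_prod => /eqP; rewrite mulf_eq0 => /orP[/eqP //|].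
  rewrite prodf_seq_eq0 => /hasP [q _ /andP [qp]].
  by rewrite hornerXsubC subr_eq0 eq_sym (negPf qp).
move=> q qp; rewrite hornerZ horner_prod; apply/eqP; rewrite mulf_eq0.
rewrite prodf_seq_eq0; apply/orP; right; apply/hasP; exists p => //.
by rewrite eq_sym qp hornerXsubC subrr eqxx.
Qed.
End PartialFractions.

(** * Positive definite matrices *)

Section PosDef.

Lemma conj_dotmx (C : numClosedFieldType) (d : nat) (x y : 'cV[C]_d) :
  Num.conj ((x^t* *m y) 0 0) = (y^t* *m x) 0 0.
Proof.
rewrite !mxE rmorph_sum; apply: eq_bigr => j _.
by rewrite !mxE rmorphM /= conjCK mulrC.
Qed.

(** By the spectral theorem the determinant is a product of eigenvalues, each of them the value of
    the form at a column of [invmx S]. *)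
Lemma det_herm_posdef (C : numClosedFieldType) (d : nat) (A : 'M[C]_d) :
  herm_posdef A -> 0 < \det A.
Proof.
move=> [Ah Apos]; have /hermitian_normalmx /orthomx_spectralP A_eq := Ah.
set S := spectralmx A in A_eq; set D := spectral_diag A in A_eq.
have uS : S \in unitmx by exact: spectral_unit.
have SV : invmx S = S^t* by rewrite invmx_unitary ?spectral_unitarymx.
rewrite A_eq !det_mulmx mulrAC -det_mulmx mulVmx // det1 mul1r det_diag.
apply: prodr_gt0 => i _.
have := Apos (col i (invmx S)).
have -> : (col i (invmx S))^t* = row i S.
  by rewrite SV; apply/rowP => j; rewrite !mxE conjCK.
rewrite A_eq rowE colE !mulmxA -(mulmxA _ S (invmx S)) mulmxV // mulmx1.
rewrite -(mulmxA _ S (invmx S)) mulmxV // mulmx1 -rowE row_diag_mx.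
rewrite -scalemxAl mul_delta_mx !mxE !eqxx mulr1.
apply; apply/negP => /eqP e0.
have := congr1 (mulmx S) e0.
rewrite mulmxA mulmxV // mul1mx mulmx0 => /colP /(_ i) /eqP.
by rewrite !mxE !eqxx oner_eq0.
Qed.
End PosDef.

(** * Independence of the kernel vectors inside the disc *)

Section Independence.
Context {R : realType} {d : nat} (M B A : 'M[R[i]]_d).
Notation C := R[i].

Lemma PsiB (z w : C) : z != 0 -> w != 0 ->
  Psi M B A z - Psi M B A w = (z - w) *: (A - (z * w)^-1 *: M).
Proof.
by move=> z0 w0; apply/matrixP => i j; rewrite !mxE; field; rewrite z0 w0.
Qed.

Hypothesis pd : forall t : R, 0 <= t <= 2 * pi ->
  herm_posdef (Psi M B A (expi t)).

Section Inside.
Variables (s : seq C) (u : C -> 'cV[C]_d) (c : C -> C).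
Hypotheses (us : uniq s) (s1 : forall w, w \in s -> w != 0 /\ `|w| < 1).
Hypothesis u0 : forall w, w \in s -> u w != 0 /\ Psi M B A w *m u w = 0.
Hypothesis cu0 : \sum_(w <- s) c w *: u w = 0.

Let f (z : C) := \sum_(w <- s) (c w * w / (z - w)) *: u w.
Let b := A *m \sum_(w <- s) (c w * w) *: u w.

Let expi_neq (t : R) (w : C) : w \in s -> expi t - w != 0.
Proof.
move=> /s1 [_]; rewrite subr_eq0; apply: contraTneq => <-.
by rewrite norm_expi ltxx.
Qed.

Let expi_neq0 (t : R) : expi t != 0.
Proof. by rewrite -normr_gt0 norm_expi. Qed.

Let Psi_f (t : R) : Psi M B A (expi t) *m f (expi t) = b.
Proof.
(* By [PsiB], the terms in [M] add up to a multiple of [M] applied to the assumed linear relation,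
   so they vanish and leave [b]. *)
transitivity (b - ((expi t)^-1 *: M) *m \sum_(w <- s) c w *: u w); last first.
  by rewrite cu0 mulmx0 subr0.
rewrite /b /f !mulmx_sumr -sumrB; apply: eq_big_seq => w ws.
have [w0 _] := s1 ws; have [_ Pw] := u0 ws.
rewrite -!scalemxAr -scalemxAl.
have -> : Psi M B A (expi t) =
    (expi t - w) *: (A - (expi t * w)^-1 *: M) + Psi M B A w.
  by rewrite -PsiB // subrK.
rewrite mulmxDl Pw addr0 -scalemxAl mulmxBl -scalemxAl !(scalerBr, scalerA).
by congr (_ *: _ - _ *: _); field; rewrite ?expi_neq // ?w0 ?expi_neq0.
Qed.

Let beta w := (b^t* *m u w) 0 0 * (c w * w).

Let b_f (z : C) : (b^t* *m f z) 0 0 = \sum_(w <- s) beta w / (z - w).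
Proof.
rewrite mulmx_sumr summxE; apply: eq_bigr => w _.
by rewrite -scalemxAr mxE /beta; ring.
Qed.

(** Since [Psi f = b] on the circle, this scalar is the conjugate of [f^* Psi f], which is positive
    unless [f] vanishes. *)
Let b_f_real (t : R) : 0 <= t <= 2 * pi ->
  Num.conj ((b^t* *m f (expi t)) 0 0) = (b^t* *m f (expi t)) 0 0.
Proof.
move=> t02; have [_ pos] := pd t02.
have E : ((f (expi t))^t* *m Psi M B A (expi t) *m f (expi t)) 0 0 =
    Num.conj ((b^t* *m f (expi t)) 0 0).
  by rewrite -mulmxA Psi_f conj_dotmx.
case: (eqVneq (f (expi t)) 0) => [->|/pos].
  by rewrite mulmx0 mxE conjC0.
by rewrite E => /gtr0_real /CrealP; rewrite conjCK => /esym.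
Qed.

Let inv (w : C) : C := (Num.conj w)^-1.

Let invK : involutive inv.
Proof. by move=> w; rewrite /inv fmorphV invrK /= conjCK. Qed.

Let inv_gt1 w : w \in s -> 1 < `|inv w|.
Proof.
by move=> /s1 [w0 w1]; rewrite normfV norm_conjC invf_gt1 // normr_gt0.
Qed.

Let conj_beta0 : \sum_(w <- s) Num.conj (beta w) * inv w = 0.
Proof.
transitivity (Num.conj ((b^t* *m \sum_(w <- s) c w *: u w) 0 0)); last first.
  by rewrite cu0 mulmx0 mxE conjC0.
rewrite mulmx_sumr summxE rmorph_sum; apply: eq_big_seq => w /s1 [w0 _].
rewrite -scalemxAr mxE /beta !rmorphM /= /inv; field.
by rewrite conjC_eq0.
Qed.

(** For [z = expi t], the conjugate of [beta w / (z - w)] is [- conj (beta w) * inv w * (1 + inv w /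
    (z - inv w))]; the constant parts cancel by [conj_beta0]. *)
Let beta_sum (t : R) : 0 <= t <= 2 * pi ->
  \sum_(w <- s) beta w / (expi t - w) +
  \sum_(w <- s) Num.conj (beta w) * inv w ^+ 2 / (expi t - inv w) = 0.
Proof.
move=> t02; rewrite -b_f -b_f_real // b_f rmorph_sum -big_split /=.
rewrite -[RHS]oppr0 -[in RHS]conj_beta0 -sumrN; apply: eq_big_seq => w ws.
have [w0 w1] := s1 ws.
have wc0 : Num.conj w != 0 by rewrite conjC_eq0.
have ze : Num.conj (expi t) = (expi t)^-1.
  by rewrite invC_norm norm_expi expr1n invr1 mul1r.
have zi : expi t - inv w != 0.
  rewrite subr_eq0; apply: contraTneq (inv_gt1 ws) => <-.
  by rewrite norm_expi ltxx.
have zi' : 1 - Num.conj w * expi t != 0.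
  apply: contraNneq zi => /eqP; rewrite subr_eq0 => /eqP e1; rewrite subr_eq0.
  by apply/eqP/(mulfI wc0); rewrite -e1 /inv mulfV.
rewrite rmorphM fmorphV /= rmorphB /= ze /inv; field.
by rewrite wc0 expi_neq0 -opprB oppr_eq0 (mulrC (expi t)) mulNr zi'.
Qed.

Let beta_eq0 w : w \in s -> beta w = 0.
Proof.
move=> ws.
(* A single residue function for both families of poles, which the unit circle separates. *)
pose g p := if p \in s then beta p else Num.conj (beta (inv p)) * p ^+ 2.
have -> : beta w = g w by rewrite /g ws.
have notin v : v \in s -> inv v \notin s.
  move=> /inv_gt1 i1; apply/negP => /s1 [_ /(lt_trans i1)].
  by rewrite ltxx.
apply: (@partial_fractions_eq0 _ (s ++ map inv s) g).
- rewrite cat_uniq us map_inj_uniq ?us ?andbT /=; last exact: (inv_inj invK).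
  by apply/hasPn => _ /mapP [v vs ->]; exact: notin.
- move=> p; rewrite mem_cat => /orP[/s1 [_ p1]|/mapP [v /inv_gt1 v1 ->]].
    by rewrite lt_eqF.
  by rewrite gt_eqF.
- move=> t t02; rewrite big_cat big_map /= -[RHS](beta_sum t02); congr (_ + _).
    by apply: eq_big_seq => v vs; rewrite /g vs.
  by apply: eq_big_seq => v vs; rewrite /g (negPf (notin _ vs)) invK.
- by rewrite mem_cat ws.
Qed.

Lemma kernel_vectors_free w : w \in s -> c w = 0.
Proof.
have f0 (t : R) : 0 <= t <= 2 * pi -> f (expi t) = 0.
  move=> t02; apply/eqP; apply: contraT => fN0.
  have [_ /(_ _ fN0)] := pd t02.
  suff -> : ((f (expi t))^t* *m Psi M B A (expi t) *m f (expi t)) 0 0 = 0.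
    by rewrite ltxx.
  rewrite -mulmxA Psi_f -conj_dotmx.
  rewrite b_f big_seq big1 ?conjC0 // => v vs.
  by rewrite beta_eq0 // mul0r.
move=> ws; have [uw0 _] := u0 ws; have [w0 _] := s1 ws.
have [i ui] : exists i, u w i 0 != 0.
  by apply/cV0Pn.
have := @partial_fractions_eq0 _ s (fun w => c w * w * u w i 0) us.
move=> /(_ _ _ w ws) /= h; apply/eqP.
have : c w * w * u w i 0 == 0.
  apply/eqP; apply: h => [p /s1 [_ p1]|t /f0 /colP /(_ i)].
    by rewrite lt_eqF.
  move=> fi; transitivity (f (expi t) i 0); last by rewrite fi mxE.
  rewrite /f summxE; apply: eq_bigr => v _.
  by rewrite !mxE; ring.
by rewrite !mulf_eq0 (negPf ui) (negPf w0) !orbF.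
Qed.
End Inside.
End Independence.

(** * The unit circle parametrized by angle *)

Section Circle.
Context {R : realType}.
Notation C := R[i].

Lemma conj_expi (t : R) : Num.conj (expi t) = (expi t)^-1.
Proof. by rewrite invC_norm norm_expi expr1n invr1 mul1r. Qed.

Lemma norm1_expi (w : C) : `|w| = 1 -> exists2 t, 0 <= t <= 2 * pi & w = expi t.
Proof.
case: w => x y /(congr1 (fun z => z ^+ 2)).
rewrite -add_Re2_Im2 expr1n => -[/= xy1].
have x1 : -1 <= x <= 1.
  rewrite -ler_norml -(@ler_pXn2r _ 2) ?nnegrE // expr1n.
  by rewrite real_normK ?num_real // -xy1 lerDl sqr_ge0.
have ct : cos (acos x) = x by rewrite acosK // in_itv.
have st : sin (acos x) = `|y|.
  by rewrite sin_acos // -xy1 addrAC subrr add0r sqrtr_sqr.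
have t0 := acos_ge0 x1; have tpi := acos_lepi x1.
have pi0 : 0 <= pi :> R := pi_ge0 R.
have [y0|y0] := leP 0 y.
  exists (acos x); first by rewrite t0 /=; lra.
  by rewrite /expi ct st ger0_norm.
exists (2 * pi - acos x); first by apply/andP; split; lra.
rewrite /expi mulr_natl addrC cosD2pi sinD2pi cosN sinN ct st.
by rewrite ltr0_norm // opprK.
Qed.

Lemma expi0 : expi (0 : R) = 1.
Proof. by rewrite /expi cos0 sin0. Qed.

Lemma expi_pihalf : expi (pi / 2 : R) = 'i.
Proof. by rewrite /expi cos_pihalf sin_pihalf. Qed.

End Circle.

(** * Symmetries of the symbol and of its zeros *)

Section Symbol.
Context {R : realType} {d : nat} (M B A : 'M[R[i]]_d).
Notation C := R[i].

Lemma Psi_inv (z : C) : Psi M B A z^-1 = Psi A B M z.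
Proof. by rewrite /Psi invrK addrAC. Qed.

Hypothesis pd : forall t : R, 0 <= t <= 2 * pi ->
  herm_posdef (Psi M B A (expi t)).

(** Inversion of [z] exchanges [A] and [M]; the swapped symbol keeps the hypothesis, so results
    inside the disc transfer outside. *)
Lemma Psi_swap_posdef (t : R) : 0 <= t <= 2 * pi ->
  herm_posdef (Psi A B M (expi t)).
Proof.
move=> t02; rewrite -Psi_inv -expiN.
have -> : expi (- t) = expi (2 * pi - t).
  by rewrite /expi (addrC _ (- t)) mulr_natl cosD2pi sinD2pi.
by apply: pd; lra.
Qed.

(** Comparing the symbol with its adjoint at 1, -1 and ['i] suffices: three values determine three
    Laurent coefficients. *)
Lemma Psi_hermitian : M = A^t* /\ B = B^t*.
Proof.
have H i j t : 0 <= t <= 2 * pi ->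
   B i j + expi t * A i j + (expi t)^-1 * M i j =
   Num.conj (B j i) + (expi t)^-1 * Num.conj (A j i) +
   expi t * Num.conj (M j i).
  move=> /pd [/is_hermitianmxP + _]; rewrite expr0 scale1r => /matrixP /(_ i j).
  by rewrite !mxE !rmorphD !rmorphM /= fmorphV /= conj_expi invrK.
have pi0 : 0 <= pi :> R := pi_ge0 R.
have i0 : 'i%C != 0 :> C by rewrite -expi_pihalf -normr_gt0 norm_expi.
have ii : ('i%C)^-1 = - 'i%C :> C.
  by rewrite -expi_pihalf -conj_expi expi_pihalf; simpc.
suff K i j : M i j = Num.conj (A j i) /\ B i j = Num.conj (B j i).
  by split; apply/matrixP => i j; rewrite !mxE; case: (K i j).
have := H i j 0; rewrite expi0 invr1 !mul1r => /(_ _) e0.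
have {}e0 := e0 ltac:(lra).
have := H i j pi; rewrite expi_pi invrN invr1 => /(_ _) e1.
have {}e1 := e1 ltac:(lra).
have := H i j (pi / 2); rewrite expi_pihalf ii => /(_ _) e2.
have {}e2 := e2 ltac:(lra).
move: (B i j) (A i j) (M i j) e0 e1 e2.
move: (Num.conj (B j i)) (Num.conj (A j i)) (Num.conj (M j i)).
move: ('i%C) i0 => k k0 b' a' m' b a m.
move=> /(congr1 (fun z => z - (b' + a' + m'))); rewrite subrr.
set D0 := (X in X = 0); move=> e0.
move=> /(congr1 (fun z => z - (b' + -1 * a' + -1 * m'))); rewrite subrr.
set D1 := (X in X = 0); move=> e1.
move=> /(congr1 (fun z => z - (b' + - k * a' + k * m'))); rewrite subrr.
set D2 := (X in X = 0); move=> e2.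
have x : b - b' = 2^-1 * (D0 + D1) by rewrite /D0 /D1; field.
have w : m - a' =
    4^-1 * (D0 - D1) - (2 * k)^-1 * (D2 - 2^-1 * (D0 + D1)).
  by rewrite /D0 /D1 /D2; field.
rewrite e0 e1 e2 in w x; split; apply/eqP; rewrite -subr_eq0 ?w ?x.
  by rewrite !(subr0, addr0, mulr0).
by rewrite addr0 mulr0.
Qed.

(** The symbol at [1 / conj w] is the conjugate transpose of the symbol at [w], by
    [Psi_hermitian]. *)
Lemma det_Psi_conj (w : C) : w != 0 ->
  \det (Psi M B A (Num.conj w)^-1) = Num.conj (\det (Psi M B A w)).
Proof.
move=> w0; rewrite -det_map_mx -det_tr; congr (\det _).
have [-> Bh] := Psi_hermitian; apply/matrixP => i j.
have Bji : B j i = Num.conj (B i j) by rewrite {1}Bh !mxE.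
by rewrite !mxE !rmorphD !rmorphM /= !conjCK fmorphV /= invrK Bji addrAC.
Qed.

Lemma zeros_conj (w : C) : zeros M B A w -> zeros M B A (Num.conj w)^-1.
Proof.
move=> [w0 dw]; split; first by rewrite invr_eq0 conjC_eq0.
by rewrite det_Psi_conj // dw conjC0.
Qed.

Lemma zeros_norm_neq1 (w : C) : zeros M B A w -> `|w| != 1.
Proof.
move=> [w0 dw]; apply/eqP => /norm1_expi [t t02 wt].
by have := det_herm_posdef (pd t02); rewrite -wt dw ltxx.
Qed.

Lemma row_free_lt1 (n : nat) (s : n.-tuple C) (u : C -> 'cV[C]_d) : uniq s ->
    (forall w, w \in s -> w != 0 /\ `|w| < 1) ->
    (forall w, w \in s -> u w != 0 /\ Psi M B A w *m u w = 0) ->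
  row_free (vecs_mx u s).
Proof.
move=> us s1 su; apply: row_free_vecs_mx => // c c0.
exact: (kernel_vectors_free pd us s1 su c0).
Qed.

Lemma zerosP_roots (r : seq C) : A \in unitmx ->
    detPsi_poly M B A =
      lead_coef (detPsi_poly M B A) *: \prod_(z <- r) ('X - z%:P) ->
  forall w, zeros M B A w <-> w \in r.
Proof.
move=> uA pE w.
have pw0 : root (detPsi_poly M B A) w = (w \in r).
  rewrite pE rootZ ?root_prod_XsubC //.
  by rewrite lead_coef_detPsi_poly // -unitfE -unitmxE.
(* The constant term [\det M] is the conjugate of [\det A], so 0 is not a root of the polynomial. *)
have M0 : \det M != 0.
  have [-> _] := Psi_hermitian.
  by rewrite det_map_mx det_tr conjC_eq0 -unitfE -unitmxE.
rewrite -pw0; split=> [[w0 dw]|/rootP pw].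
  by apply/rootP; rewrite detPsi_polyE // dw mulr0.
have w0 : w != 0.
  by apply: contra_eq_neq pw => ->; rewrite detPsi_poly0.
split => //; move: pw; rewrite detPsi_polyE // => /eqP.
by rewrite mulf_eq0 expf_eq0 (negPf w0) andbF /= => /eqP.
Qed.

End Symbol.

(** * Independence of the kernel vectors outside the disc, by inversion *)

Section Outside.
Context {R : realType} {d : nat} (M B A : 'M[R[i]]_d).
Notation C := R[i].
Hypothesis pd : forall t : R, 0 <= t <= 2 * pi ->
  herm_posdef (Psi M B A (expi t)).

Lemma row_free_gt1 (n : nat) (s : n.-tuple C) (u : C -> 'cV[C]_d) : uniq s ->
    (forall w, w \in s -> 1 < `|w|) ->
    (forall w, w \in s -> u w != 0 /\ Psi M B A w *m u w = 0) ->
  row_free (vecs_mx u s).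
Proof.
move=> us s1 su.
have -> : vecs_mx u s = vecs_mx (fun w => u w^-1) (map_tuple GRing.inv s).
  by apply/matrixP => i j; rewrite !mxE tnth_map invrK.
apply: (row_free_lt1 (Psi_swap_posdef pd)).
- by rewrite map_inj_uniq //; exact: invr_inj.
- move=> _ /mapP [w ws ->]; have w1 := s1 _ ws.
  have w0 : w != 0 by rewrite -normr_gt0 (lt_trans ltr01).
  by rewrite invr_eq0 w0 normfV invf_lt1 ?w1 // normr_gt0.
- by move=> _ /mapP [w ws ->]; rewrite -Psi_inv invrK; exact: su.
Qed.

End Outside.

(** * The mean of the logarithm of the determinant *)

Section JensenSum.
Context {R : realType}.
Notation mu := (@lebesgue_measure R).

Lemma Rintegral_sum_ln_nsq (k : R) (s : seq R[i]) :
    (forall a, a \in s -> `|a| < 1) ->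
  \int[mu]_(t in `[0, 2 * pi]) (k + \sum_(a <- s) ln (nsq (1 - a * expi t))) =
  k * (2 * pi).
Proof.
elim: s => [|a s IHs] s1.
  under eq_Rintegral do rewrite big_nil addr0.
  rewrite Rintegral_cst //= lebesgue_measure_itv /= lte_fin.
  by rewrite mulr_gt0 ?pi_gt0 //= subr0.
have s1' b : b \in s -> `|b| < 1 by move=> bs; apply: s1; rewrite inE bs orbT.
have a1 : `|a| < 1 by apply: s1; rewrite mem_head.
rewrite -[RHS](IHs s1') -[RHS]add0r -[X in _ = X + _](Rintegral_ln_nsq a1).
under eq_Rintegral do rewrite big_cons addrCA.
rewrite [LHS]RintegralD //.
  apply: (@continuous_itv_integrable _ (fun t => ln (nsq (1 - a * expi t)))).
  exact: continuous_ln_nsq.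
apply: (@continuous_itv_integrable _
  (fun t => k + \sum_(b <- s) ln (nsq (1 - b * expi t)))).
move=> t; apply: cvgD; first exact: cvg_cst.
elim: s {IHs s1} s1' => [|b s IHs] s1.
  under eq_fun do rewrite big_nil.
  by rewrite big_nil; exact: cvg_cst.
under eq_fun do rewrite big_cons.
rewrite big_cons; apply: cvgD.
  by apply: continuous_ln_nsq; apply: s1; rewrite mem_head.
by apply: IHs => c cs; apply: s1; rewrite inE cs orbT.
Qed.

End JensenSum.

Section Factorization.
Context {R : realType} {d : nat} (M B A : 'M[R[i]]_d).
Notation C := R[i].
Hypothesis pd : forall t : R, 0 <= t <= 2 * pi ->
  herm_posdef (Psi M B A (expi t)).

(** On the circle [(z - 1 / conj w) * (z - w) = z * (- w) * |1 - z / w| ^ 2]. Over the [d] pairs the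
    powers of [z] cancel [z ^ d], and only the constant survives the mean. *)
Lemma mean_log_det_zeros (r1 r2 : d.-tuple C) :
    (forall w, w \in r2 -> 1 < `|w|) ->
    perm_eq r1 [seq (Num.conj w)^-1 | w <- r2] ->
    detPsi_poly M B A = \det A *: \prod_(z <- r1 ++ r2) ('X - z%:P) ->
  (expR (mean_log_det M B A))%:C = \det A * \prod_(w <- r2) - w.
Proof.
move=> r2gt r12 pE.
pose g := \det A * \prod_(w <- r2) - w; rewrite -/g.
pose s := [seq w^-1 | w <- r2].
have r2N0 w : w \in r2 -> w != 0.
  by move=> /r2gt w1; rewrite -normr_gt0 (lt_trans ltr01).
have s1 a : a \in s -> `|a| < 1.
  move=> /mapP [w wr ->]; rewrite normfV invf_lt1 ?r2gt // normr_gt0.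
  exact: r2N0.
have detE t : \det (Psi M B A (expi t)) =
    g * (\prod_(a <- s) nsq (1 - a * expi t))%:C.
  have z0 : expi t != 0 :> C by rewrite -normr_gt0 norm_expi.
  have zd : expi t ^+ d != 0 by rewrite expf_neq0.
  apply: (mulfI zd); rewrite -detPsi_polyE // pE hornerZ horner_prod big_cat /=.
  rewrite (perm_big _ r12) big_map /= /g rmorph_prod big_map /=.
  have -> : expi t ^+ d = \prod_(w <- r2) expi t.
    by rewrite big_tuple prodr_const card_ord.
  rewrite -(mulrA (\det A)) [RHS]mulrCA; congr (_ * _); rewrite -!big_split /=.
  apply: eq_big_seq => w wr; have w0 := r2N0 _ wr.
  have wc0 : Num.conj w != 0 by rewrite conjC_eq0.
  have -> : (nsq (1 - w^-1 * expi t))%:C =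
     (1 - w^-1 * expi t) * (1 - (Num.conj w)^-1 * (expi t)^-1).
    rewrite nsqC; congr (_ * _).
    transitivity (Num.conj (1 - w^-1 * expi t)); first by [].
    by rewrite rmorphB rmorph1 rmorphM /= fmorphV /= conj_expi.
  rewrite !hornerXsubC; field; by rewrite w0 wc0 z0.
have P0 t : 0 < \prod_(a <- s) nsq (1 - a * expi t).
  rewrite big_seq; apply: prodr_gt0 => a /s1 a1.
  by rewrite nsq_gt0 one_sub_expi_neq0.
have pi0 : 0 < pi :> R := pi_gt0 R.
(* Positivity of the determinant at [t = 0] forces the complex constant [g] to be real and
   positive. *)
have g0 : 0 < g.
  have /det_herm_posdef : herm_posdef (Psi M B A (expi 0)).
    by apply: pd; rewrite lexx /=; lra.
  by rewrite detE pmulr_lgt0 // -[0]/(0%:C) ltcR.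
have gE : g = (complex.Re g)%:C by rewrite RRe_real // gtr0_real.
have Rg0 : 0 < complex.Re g by rewrite -ltcR -gE.
rewrite gE; congr (_%:C).
rewrite /mean_log_det.
have -> : \int[lebesgue_measure]_(t in `[0, 2 * pi])
    ln (complex.Re (\det (Psi M B A (expi t)))) = ln (complex.Re g) * (2 * pi).
  rewrite -(Rintegral_sum_ln_nsq _ s1); apply: eq_Rintegral => t _.
  rewrite detE gE -rmorphM /= lnM ?posrE //; congr (_ + _).
  elim: {detE P0} s s1 => [|a s IHs] s1; first by rewrite !big_nil ln1.
  have s1' b : b \in s -> `|b| < 1 by move=> bs; apply: s1; rewrite inE bs orbT.
  rewrite !big_cons lnM ?IHs // posrE.
    by rewrite nsq_gt0 one_sub_expi_neq0 // s1 // mem_head.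
  rewrite big_seq; apply: prodr_gt0 => b /s1' b1.
  by rewrite nsq_gt0 one_sub_expi_neq0.
rewrite mulrCA mulVf ?mulr1 ?lnK ?posrE //.
by rewrite mulf_neq0 // gt_eqF.
Qed.

End Factorization.

(** * Counting the zeros and evaluating the Toeplitz determinant *)

Theorem theorem8p1 (R : realType) (d : nat) (Psim1 Psi0 Psi1 : 'M[R[i]]_d)
    (u : R[i] -> 'cV[R[i]]_d) :
  (1 <= d)%N ->
  (forall t : R, 0 <= t <= 2 * pi ->
     herm_posdef (Psi Psim1 Psi0 Psi1 (expi t))) ->
  Psi1 \in unitmx ->
  assumptionII Psim1 Psi0 Psi1 ->
  kernel_vectors Psim1 Psi0 Psi1 u ->
  let GL := Psim1 *m invmx (W_gt1 Psim1 Psi0 Psi1 u) in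
  let GR := Psi1 *m W_lt1 Psim1 Psi0 Psi1 u in
  forall P : nat, (1 <= P)%N ->
    \det (toeplitz Psim1 Psi0 Psi1 GL GR P) =
    (expR (mean_log_det Psim1 Psi0 Psi1))%:C ^+ P * \det (GL + GR + Psi0).
Proof.
move=> _ pd uA simple_zeros ku GL GR P _.
pose M := Psim1; pose B := Psi0; pose A := Psi1.
have ku' w : zeros M B A w -> u w != 0 /\ Psi M B A w *m u w = 0.
  move=> /ku [u0 /eqmxP/eqmxP/andP [+ _]]; split=> //.
  apply: trmx_inj; rewrite trmx_mul trmx0; exact/sub_kermxP.
have [r pE] := closed_field_poly_normal (detPsi_poly M B A).
have zr := zerosP_roots pd uA pE.
have A0 : \det A != 0 by rewrite -unitfE -unitmxE.
rewrite lead_coef_detPsi_poly // in pE.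
have size_r : size r = (d + d)%N.
  have := size_detPsi_poly M B uA; rewrite pE size_scale // size_prod_XsubC.
  by case.
(* Simplicity of the zeros excludes repetitions in the list of roots. *)
have uniq_r : uniq r.
  apply: count_mem_uniq => w.
  case: (boolP (w \in r)) => [wr|/count_memPn -> //].
  have [+ _] := simple_zeros _ ((zr w).2 wr).
  by rewrite -/M -/B -/A pE -mul_polyC mupMr ?rootC // mu_prod_XsubC => ->.
pose r1 := [seq w <- r | `|w| < 1]; pose r2 := [seq w <- r | ~~ (`|w| < 1)].
have r1P w : w \in r1 -> [/\ w \in r, w != 0 & `|w| < 1].
  by rewrite mem_filter => /andP [w1 wr]; split=> //; case: ((zr w).2 wr).
have r2P w : w \in r2 -> w \in r /\ 1 < `|w|.
  rewrite mem_filter => /andP [w1 wr]; split=> //.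
  rewrite lt_neqAle eq_sym (zeros_norm_neq1 pd ((zr w).2 wr)) /=.
  by rewrite real_leNgt ?real1 ?normr_real.
have r12 : perm_eq (r1 ++ r2) r by rewrite perm_filterC.
have uniq_r1 : uniq r1 by rewrite filter_uniq.
have uniq_r2 : uniq r2 by rewrite filter_uniq.
have free1 n (s : n.-tuple R[i]) : r1 = s -> row_free (vecs_mx u s).
  move=> r1s; have ms w : (w \in s) = (w \in r1) by rewrite r1s.
  apply: (row_free_lt1 pd); first by rewrite -r1s.
    by move=> w; rewrite ms => /r1P [].
  by move=> w; rewrite ms => /r1P [wr _ _]; apply/ku'/zr.
have free2 n (s : n.-tuple R[i]) : r2 = s -> row_free (vecs_mx u s).
  move=> r2s; have ms w : (w \in s) = (w \in r2) by rewrite r2s.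
  apply: (row_free_gt1 pd); first by rewrite -r2s.
    by move=> w; rewrite ms => /r2P [].
  by move=> w; rewrite ms => /r2P [wr _]; apply/ku'/zr.
(* Each side has at most [d] zeros, by independence of their vectors in dimension [d]; the total
   [2 d] then forces equality on both. *)
have size_r1 : (size r1 <= d)%N.
  have /eqP <- := free1 _ (in_tuple r1) erefl; exact: rank_leq_col.
have size_r2 : (size r2 <= d)%N.
  have /eqP <- := free2 _ (in_tuple r2) erefl; exact: rank_leq_col.
have := perm_size r12; rewrite size_cat size_r => size12.
have s1 : size r1 == d.
  by rewrite eqn_leq size_r1 -(leq_add2r d) -size12 leq_add2l.
have s2 : size r2 == d.
  by rewrite eqn_leq size_r2 -(leq_add2l d) -size12 leq_add2r.
have {}free1 := free1 _ (Tuple s1) erefl.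
have {}free2 := free2 _ (Tuple s2) erefl.
pose W := W_lt1 M B A u; pose V := W_gt1 M B A u.
have Wu : forall w, w \in r1 -> W *m u w = w *: u w.
  apply: (eigmxP free1) => w; split=> [[/zr wr w1]|/r1P [wr _ w1]].
    by rewrite mem_filter w1.
  by split=> //; apply/zr.
have Vu : forall w, w \in r2 -> V *m u w = w *: u w.
  apply: (eigmxP free2) => w; split=> [[/zr wr w1]|/r2P [wr w1]].
    by rewrite mem_filter wr -real_leNgt ?real1 ?normr_real // ltW.
  by split=> //; apply/zr.
(* On the basis vector [u w] the left side acts as [w *: Psi(w)], which kills it. *)
have quadV : A *m V *m V + B *m V + M = 0.
  apply: (mx_eq0_vecs free2) => w wr; have Vw := Vu w wr.
  have /zr zw := (r2P w wr).1; have [w0 _] := zw; have [_ Pw] := ku' _ zw.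
  rewrite -[RHS](scaler0 _ w) -Pw !mulmxDl -!mulmxA !Vw -!scalemxAr Vw.
  rewrite -!scalemxAr /Psi !scalerDr -!scalemxAl !scalerA mulfV // scale1r.
  by rewrite (addrC (w *: _)).
have detV : \det V = \prod_(w <- r2) w by exact: (det_eigvecs free2 Vu).
have uV : V \in unitmx.
  rewrite unitmxE detV unitfE prodf_seq_neq0; apply/allP => w /r2P [_ w1] /=.
  by rewrite -normr_gt0 (lt_trans ltr01).
have GLV : M = GL *m V by rewrite /GL mulmxKV.
(* Cancelling [V] on the right of [quadV] leaves [A V + B + GL = 0]. *)
have BE : B = - GL - A *m V.
  have : (A *m V + B + GL) *m V = 0 by rewrite !mulmxDl -GLV quadV.
  move/(congr1 (mulmx^~ (invmx V))); rewrite mulmxK // mul0mx => /eqP.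
  rewrite addrAC addrC addr_eq0 => /eqP ->.
  by rewrite opprD addrC.
have detNV : \det (- V) = \prod_(w <- r2) - w.
  under eq_bigr do rewrite -mulN1r.
  rewrite big_split /= -detV -scaleN1r detZ; congr (_ * _).
  by rewrite -[r2]/(tval (Tuple s2)) big_tuple prodr_const card_ord.
(* Reflection maps the outer zeros injectively to inner ones, and the two counts agree. *)
have conj_perm : perm_eq (Tuple s1) [seq (Num.conj w)^-1 | w <- Tuple s2].
  have um : uniq [seq (Num.conj w)^-1 | w <- r2].
    rewrite map_inj_uniq // => x y /invr_inj; exact: (inv_inj conjCK).
  rewrite perm_sym; apply: uniq_perm => //=.
  have [] // := uniq_min_size um (s2 := r1); last first.
    by rewrite size_map (eqP s1) (eqP s2).
  move=> _ /mapP [w /r2P [wr w1] ->]; rewrite mem_filter normfV norm_conjC.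
  rewrite invf_lt1 ?w1 ?(lt_trans ltr01) //=.
  by apply/zr/(zeros_conj pd)/zr.
have pE' : detPsi_poly M B A =
    \det A *: \prod_(z <- (Tuple s1 : seq _) ++ (Tuple s2 : seq _)) ('X - z%:P).
  by rewrite /= (perm_big _ r12).
have r2gt w : w \in Tuple s2 -> 1 < `|w| by move=> /r2P [].
rewrite (mean_log_det_zeros pd r2gt conj_perm pE') -detNV.
have -> : GL + GR + Psi0 = A *m (W - V).
  by rewrite -/B BE mulmxBr addrACA subrr add0r.
by rewrite -(det_toeplitz_factored P A V W GL) -GLV -BE.
Qed.
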